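(* For all positive integers $n$ and $N$ with $N\ge n$, the equality $$W(n,N)=\bar W(n,N)$$ holds in the group $\mathcal B(n,N)$, where $W(n,N)$ is the product of all generators of $\mathcal B(n,N)$ in lexicographic order and $\bar W(n,N)$ is the product of the same factors in the reverse order.
   Context: For positive integers $N\ge n$, $\mathcal B(n,N)$ is the group with $\binom Nn$ generators $R_{a_1,\dots,a_n}$, $1\le a_1<a_2<\dots<a_n\le N$, and the following defining relations. (1) $R_{a_1,\dots,a_n}R_{b_1,\dots,b_n}=R_{b_1,\dots,b_n}R_{a_1,\dots,a_n}$ unless the set $\{a_1,\dots,a_n\}\cap\{b_1,\dots,b_n\}$ has exactly $n-1$ elements. (2) If $N>n$, then for every $1\le a_1<\dots<a_{n+1}\le N$, $$\prod^{\rightarrow}_{1\le j\le n+1}R_{a_1,\dots,\check a_j,\dots,a_{n+1}}=\prod^{\leftarrow}_{1\le j\le n+1}R_{a_1,\dots,\check a_j,\dots,a_{n+1}},$$ where $\check a_j$ means that $a_j$ is dropped, $\prod^{\rightarrow}$ means that the factors are written from left to right with $j$ increasing, and $\prod^{\leftarrow}$ with $j$ decreasing. $W(n,N)=\prod^{\rightarrow}_{1\le a_1<\dots<a_n\le N}R_{a_1,\dots,a_n}$, with factors from left to right in increasing lexicographic order of $(a_1,\dots,a_n)$. $\eta$ is the involutive anti-automorphism of $\mathcal B(n,N)$ fixing every generator $R_{a_1,\dots,a_n}$, and $\bar W(n,N)=\eta(W(n,N))$. *)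

(* Defs.v *)
From HB Require Import structures.
From mathcomp Require Import all_boot all_order.
From mathcomp Require Import boolp.

Set Implicit Arguments.
Unset Strict Implicit.
Unset Printing Implicit Defensive.

Import Order.TTheory.

Local Open Scope quotient_scope.
Local Open Scope group_scope.

Section Presentation.

(* The group with generators X and relations x_1 ... x_k = y_1 ... y_l for all
   rels [:: x_1; ...; x_k] [:: y_1; ...; y_l]. The letter (x, true) stands for
   x and (x, false) for its inverse. *)
Variables (X : choiceType) (rels : seq X -> seq X -> Prop).

Definition word := seq (X * bool).

Definition posw (s : seq X) : word := [seq (x, true) | x <- s].

Definition invw (w : word) : word := [seq (l.1, ~~ l.2) | l <- rev w].

Inductive word_cong : word -> word -> Prop :=
| WCrefl u : word_cong u u
| WCsym u v : word_cong u v -> word_cong v u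
| WCtrans u v w : word_cong u v -> word_cong v w -> word_cong u w
| WCcat u u' v v' :
    word_cong u u' -> word_cong v v' -> word_cong (u ++ v) (u' ++ v')
| WCcancel x b : word_cong [:: (x, b); (x, ~~ b)] [::]
| WCrel s t : rels s t -> word_cong (posw s) (posw t).

(* Classical logic turns the (possibly undecidable) congruence into a boolean relation. *)
Definition word_eqv : rel word := fun u v => `[< word_cong u v >].

Lemma word_eqvP : equiv_class_of word_eqv.
Proof.
split=> [u|u v|v u w].
- exact/asboolP/WCrefl.
- by apply/asboolP/asboolP; apply: WCsym.
- by move=> /asboolP uv /asboolP vw; apply/asboolP/(WCtrans uv).
Qed.

Canonical word_eqv_equiv := EquivRelPack word_eqvP.

Definition presented := {eq_quot word_eqv}.
HB.instance Definition _ := Choice.on presented.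

Definition pclass (w : word) : presented := \pi_presented w.

Lemma pclassP u v : word_cong u v <-> pclass u = pclass v.
Proof. by split=> [uv|/eqmodP/asboolP//]; apply/eqmodP/asboolP. Qed.

Lemma pclassK x : pclass (repr x) = x.
Proof. exact: reprK. Qed.

Lemma repr_pclass w : word_cong (repr (pclass w)) w.
Proof. by apply/pclassP; rewrite pclassK. Qed.

Definition pmul (x y : presented) := pclass (repr x ++ repr y).
Definition pinv (x : presented) := pclass (invw (repr x)).

Lemma pclass_cat u v : pclass (u ++ v) = pmul (pclass u) (pclass v).
Proof. by apply/pclassP/WCsym/WCcat; apply: repr_pclass. Qed.

Lemma invwK : involutive invw.
Proof.
move=> w; rewrite /invw -map_rev revK -map_comp -[RHS]map_id.
by apply: eq_map => -[x b] /=; rewrite negbK.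
Qed.

Lemma cat_invw w : word_cong (w ++ invw w) [::].
Proof.
elim: w => [|[x b] w IH]; first exact: WCrefl.
rewrite /invw rev_cons map_rcons -cats1 cat_cons catA.
have e := WCcat (WCrefl [:: (x, b)]) (WCcat IH (WCrefl [:: (x, ~~ b)])).
exact: WCtrans e (WCcancel x b).
Qed.

Lemma pmulA : associative pmul.
Proof.
move=> x y z; rewrite -(pclassK x) -(pclassK y) -(pclassK z).
by rewrite -!pclass_cat catA.
Qed.

Lemma pmul1 : left_id (pclass [::]) pmul.
Proof. by move=> x; rewrite -(pclassK x) -pclass_cat. Qed.

Lemma pmulr1 : right_id (pclass [::]) pmul.
Proof. by move=> x; rewrite -(pclassK x) -pclass_cat cats0. Qed.

Lemma pmulrV : right_inverse (pclass [::]) pinv pmul.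
Proof.
move=> x; rewrite -{1}(pclassK x) /pinv -pclass_cat.
exact/pclassP/cat_invw.
Qed.

Lemma pmulV : left_inverse (pclass [::]) pinv pmul.
Proof.
move=> x; rewrite -{2}(pclassK x) /pinv -pclass_cat -{2}(invwK (repr x)).
exact/pclassP/cat_invw.
Qed.

HB.instance Definition _ :=
  isGroup.Build presented pmulA pmul1 pmulr1 pmulV pmulrV.

Definition pgen (x : X) : presented := pclass [:: (x, true)].

Lemma pclassM u v : pclass (u ++ v) = pclass u * pclass v.
Proof. exact: pclass_cat. Qed.

Lemma pclass_posw s : pclass (posw s) = \prod_(x <- s) pgen x.
Proof.
elim: s => [|x s IH]; first by rewrite big_nil.
by rewrite big_cons -IH -pclassM.
Qed.

Lemma presented_rel s t :
  rels s t -> \prod_(x <- s) pgen x = \prod_(x <- t) pgen x.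
Proof. by move=> st; rewrite -!pclass_posw; apply/pclassP/WCrel. Qed.

Lemma presented_univ (G : groupType) (f : X -> G) :
    (forall s t, rels s t -> \prod_(x <- s) f x = \prod_(x <- t) f x) ->
  exists2 phi : presented -> G,
    {morph phi : x y / x * y} & forall x, phi (pgen x) = f x.
Proof.
move=> fP; pose F (w : word) := \prod_(l <- w) (if l.2 then f l.1 else (f l.1)^-1).
have FC u v : word_cong u v -> F u = F v.
  elim=> {u v} //; rewrite /F.
  - by move=> u v w _ -> _ ->.
  - by move=> u u' v v' _ eu _ ev; rewrite !big_cat /= eu ev.
  - move=> x b; rewrite !big_cons !big_nil mulg1.
    by case: b; rewrite /= ?mulgV ?mulVg.
  - by move=> s t /fP; rewrite !big_map.
exists (fun x => F (repr x)) => [x y|x].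
  by rewrite (FC _ _ (repr_pclass _)) /F big_cat.
by rewrite (FC _ _ (repr_pclass _)) /F big_seq1.
Qed.

Lemma pgen_ind (P : presented -> Prop) :
  P 1 -> (forall x y, P x -> P y -> P (x * y)) ->
  (forall x, P (pgen x)) -> (forall x, P (pgen x)^-1) -> forall x, P x.
Proof.
move=> P1 PM Pg PV x; rewrite -(pclassK x).
elim: (repr x) => [|[y b] w IH]; first exact: P1.
rewrite -cat1s pclassM; apply: PM => //.
case: b; first exact: Pg.
suff <- : (pgen y)^-1 = pclass [:: (y, false)] by [].
apply: (mulgI (pgen y)); rewrite mulgV -pclassM; symmetry.
exact/pclassP/(WCcancel y true).
Qed.

(* Word reversal; this induces an anti-automorphism when rels is stable under
   reversal of both sides. *)
Definition prev (x : presented) : presented := pclass (rev (repr x)).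

Hypothesis rels_rev : forall s t, rels s t -> word_cong (posw (rev s)) (posw (rev t)).

Lemma word_cong_rev u v : word_cong u v -> word_cong (rev u) (rev v).
Proof.
elim=> {u v}.
- by move=> u; apply: WCrefl.
- by move=> u v _; apply: WCsym.
- by move=> u v w _ uv _; apply: WCtrans uv.
- by move=> u u' v v' _ eu _ ev; rewrite !rev_cat; apply: WCcat.
- by move=> x b; rewrite -{1}(negbK b); apply: WCcancel.
- by move=> s t /rels_rev; rewrite /posw !map_rev.
Qed.

Lemma prev_pclass w : prev (pclass w) = pclass (rev w).
Proof. by apply/pclassP/word_cong_rev/repr_pclass. Qed.

Lemma prevM : {morph prev : x y / x * y >-> y * x}.
Proof.
move=> x y; rewrite -(pclassK x) -(pclassK y) -pclassM !prev_pclass rev_cat.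
by rewrite pclassM.
Qed.

Lemma prevK : involutive prev.
Proof. by move=> x; rewrite -(pclassK x) !prev_pclass revK. Qed.

Lemma prev_gen x : prev (pgen x) = pgen x.
Proof. by rewrite prev_pclass. Qed.

End Presentation.

(* Increasing sequences a_1 < ... < a_n of indices; the index set {1, ..., N} is
   represented by 'I_N, i.e. shifted to {0, ..., N - 1}. *)
Record incr_seq (n N : nat) : predArgType := IncrSeq {
  ival :> n.-tuple 'I_N;
  _ : sorted <%O ival
}.
HB.instance Definition _ n N := [isSub for @ival n N].
HB.instance Definition _ n N := [Finite of incr_seq n N by <:].

Lemma card_incr_seq n N : #|{: incr_seq n N}| = 'C(N, n).
Proof.
rewrite card_sub -card_ltn_sorted_tuples cardsE.
by apply: eq_card => t; rewrite !inE unfold_in /= sorted_map.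
Qed.

Lemma del_subproof n N (a : incr_seq n.+1 N) (j : 'I_n.+1) :
  sorted <%O [tuple tnth a (lift j i) | i < n].
Proof.
have x0 : 'I_N := tnth a j.
apply/(sortedP x0) => i; rewrite size_map size_enum_ord => lti.
have lti' := ltnW lti.
rewrite -[i]/(val (Ordinal lti')) -[i.+1]/(val (Ordinal lti)) !nth_mktuple.
rewrite !(tnth_nth x0).
apply: sorted_ltn_nth (valP a) _ _ _ _ _; first exact: lt_trans.
- by rewrite inE size_tuple ltn_ord.
- by rewrite inE size_tuple ltn_ord.
- by rewrite /= /bump addnS ltnS leq_add2r; case: (leqP j i) => // /leqW ->.
Qed.

(* Drops the j-th entry of a: lift j enumerates the positions other than j. *)
Definition del n N (a : incr_seq n.+1 N) (j : 'I_n.+1) : incr_seq n N :=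
  IncrSeq (del_subproof a j).

Inductive Brel (n N : nat) : seq (incr_seq n N) -> seq (incr_seq n N) -> Prop :=
| Brel_comm (a b : incr_seq n N) :
    #|[set i in ival a] :&: [set i in ival b]| <> n.-1 -> Brel [:: a; b] [:: b; a]
| Brel_simplex (a : incr_seq n.+1 N) :
    Brel [seq del a j | j <- enum 'I_n.+1] (rev [seq del a j | j <- enum 'I_n.+1]).

Definition B (n N : nat) := presented (@Brel n N).
HB.instance Definition _ n N := Group.on (B n N).

Definition R n N (a : incr_seq n N) : B n N := pgen (@Brel n N) a.

Lemma B_comm n N (a b : incr_seq n N) :
  #|[set i in ival a] :&: [set i in ival b]| <> n.-1 -> R a * R b = R b * R a.
Proof.
by move/Brel_comm/presented_rel; rewrite !big_cons !big_nil !mulg1.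
Qed.

Lemma B_simplex n N (a : incr_seq n.+1 N) :
  \prod_(j < n.+1) R (del a j) = \prod_(j < n.+1) R (del a (rev_ord j)).
Proof.
have /presented_rel := Brel_simplex a.
rewrite -map_rev !(big_map (del a)) => eE.
have oE : index_enum 'I_n.+1 = enum 'I_n.+1 by rewrite enumT [index_enum _]unlock.
rewrite oE [LHS]eE -(big_map (@rev_ord n.+1) xpredT (fun j => R (del a j))).
congr (\big[_/_]_(j <- _) _).
apply: (@eq_from_nth _ ord0) => [|i]; rewrite size_rev size_enum_ord.
  by rewrite size_map size_enum_ord.
move=> lti; apply: val_inj; rewrite nth_rev size_enum_ord //.
rewrite (nth_map ord0) ?size_enum_ord // [RHS]/= nth_enum_ord //.
by rewrite [LHS]nth_enum_ord // subSS ltnS leq_subr.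
Qed.

Lemma Brel_rev n N (s t : seq (incr_seq n N)) :
  Brel s t -> word_cong (@Brel n N) (posw (rev s)) (posw (rev t)).
Proof.
case=> [a b ab|a]; apply: WCsym; first exact/WCrel/Brel_comm.
by rewrite revK; apply/WCrel/Brel_simplex.
Qed.

(* The operation prev is an anti-automorphism here by Brel_rev. *)
Definition eta n N : B n N -> B n N := @prev _ (@Brel n N).

Lemma etaM n N : {morph @eta n N : x y / x * y >-> y * x}.
Proof. exact: prevM (@Brel_rev n N). Qed.

Lemma etaK n N : involutive (@eta n N).
Proof. exact: prevK (@Brel_rev n N). Qed.

Lemma eta_R n N (a : incr_seq n N) : eta (R a) = R a.
Proof. exact: prev_gen (@Brel_rev n N) a. Qed.

Lemma eta1 n N : eta (1 : B n N) = 1.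
Proof. by apply: (mulgI (eta 1)); rewrite -etaM !mulg1. Qed.

Definition lex_seqs n N : seq (incr_seq n N) :=
  sort (fun a b => (ival a : n.-tuplelexi 'I_N) <= ival b)%O
       (enum {: incr_seq n N}).

Definition W n N : B n N := \prod_(a <- lex_seqs n N) R a.

Definition Wbar n N : B n N := eta (W n N).

Lemma WbarE n N : Wbar n N = \prod_(a <- rev (lex_seqs n N)) R a.
Proof.
rewrite /Wbar /W; elim: (lex_seqs n N) => [|a s IH].
  by rewrite !big_nil eta1.
by rewrite big_cons etaM eta_R IH rev_cons -cats1 big_cat big_seq1.
Qed.

(* Main.v *)
(* Splitting the generators according to whether the first point 1 occurs gives
   W(n, N) = X Y with X the product of the R_{1,b} and Y a copy of W(n, N - 1).
   The simplex relation of 1 :: c lets R_c pass through the packet of the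
   R_{1,b}, b \subset c, reversing it. Letting all R_c pass in lexicographic
   order reverses X completely (the lexicographic maximal chain of Manin and
   Schechtman's higher Bruhat order), so X Y = Y X^rev = Y^rev X^rev by
   induction on N. *)
Require Import Defs.
From mathcomp Require Import all_boot.
From mathcomp Require Import all_order.

Set Implicit Arguments.
Unset Strict Implicit.
Unset Printing Implicit Defensive.

Import Order.TTheory.

Local Open Scope group_scope.

(** * Subsequences of fixed length in lexicographic order *)

(** Plain sequences stand in for [incr_seq] so that products can be split by induction on the ground
    sequence. *)
Fixpoint ksubs (T : Type) k (s : seq T) : seq (seq T) :=
  match k, s with
  | 0, _ => [:: [::]]
  | _.+1, [::] => [::]
  | k'.+1, a :: t => [seq a :: b | b <- ksubs k' t] ++ ksubs k t
  end.

Section SubsetSequences.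

Variable T : eqType.
Implicit Types (k : nat) (s b c : seq T).

Lemma mem_ksubs k s b : (b \in ksubs k s) = (size b == k) && subseq b s.
Proof.
elim: s k b => [|a t IH] [|k] [|e b] //=.
- by rewrite andbC.
- by rewrite mem_cat IH orbF; apply/mapP => -[].
- rewrite mem_cat IH [size _]/= eqSS; have [<-|ne] := eqVneq e a.
    rewrite mem_map ?IH => [|? ? [] //].
    case: (size b == k) => //=; apply: orb_idr => ebt.
    exact: subseq_trans (subseq_cons b e) ebt.
  suff /negPf -> : e :: b \notin [seq a :: d | d <- ksubs k t] by [].
  by apply/mapP => -[d _ [/eqP]]; rewrite (negPf ne).
Qed.

Lemma ksubs_uniq k s : uniq s -> uniq (ksubs k s).
Proof.
elim: s k => [|a t IH] [|k] //= /andP[at_ ut].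
rewrite cat_uniq map_inj_uniq ?IH // => [|? ? [] //]; rewrite andbT.
apply/hasPn => b; rewrite mem_ksubs => /andP[_ /mem_subseq bt].
by apply/mapP => -[d _ db]; move: at_; rewrite bt // db mem_head.
Qed.

Lemma size_ksubs k s b : b \in ksubs k s -> size b = k.
Proof. by rewrite mem_ksubs => /andP[/eqP]. Qed.

Lemma ksubs_notin a k s b : a \notin s -> b \in ksubs k s -> a \notin b.
Proof.
by move=> as_; rewrite mem_ksubs => /andP[_ /mem_subseq bs]; apply: contra as_ => /bs.
Qed.

Lemma count_ksubs_cons a k s b c :
  a \notin s -> b \in ksubs k s -> count (mem (a :: c)) b = count (mem c) b.
Proof.
move=> as_ /(ksubs_notin as_) ab; apply: eq_in_count => e eb; rewrite /= inE.
by case: eqP => // ea; rewrite -ea eb in ab.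
Qed.

Lemma ksubs_gt k s : size s < k -> ksubs k s = [::].
Proof.
elim: s k => [|a t IH] [|k] //= lt_sk.
by rewrite !IH // ltnW.
Qed.

Lemma ksubs_size s : ksubs (size s) s = [:: s].
Proof. by elim: s => //= a t ->; rewrite ksubs_gt. Qed.

Lemma ksubs_cons_size a k s :
  size s = k.+1 -> ksubs k.+1 (a :: s) = rcons [seq a :: b | b <- ksubs k s] s.
Proof. by move=> sz; rewrite /= -sz ksubs_size cats1. Qed.

(** Lists keeping the head come before the one dropping it, so position 0 is dropped last: the
    dropped positions decrease. *)
Lemma ksubs_drop1 k s : size s = k.+1 ->
  ksubs k s = rev [seq take j s ++ drop j.+1 s | j <- iota 0 k.+1].
Proof.
elim: s k => // a t IH [|k] [sz].
  by rewrite /= drop0 (size0nil sz).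
rewrite ksubs_cons_size // (IH k) // -[iota 0 k.+2]/(0 :: iota 1 k.+1).
rewrite (iotaDl 1 0) map_cons rev_cons map_rev -2!map_comp.
by congr (rcons (rev _) _); rewrite /= drop0.
Qed.

End SubsetSequences.

(** Lists through the head come first, and all the others start with a larger entry. *)
Lemma ksubs_le d (T : orderType d) k (s : seq T) : sorted <%O s ->
  pairwise (fun b c : seqlexi T => b <= c)%O (ksubs k s).
Proof.
rewrite lt_sorted_pairwise; elim: s k => [|a t IH] [|k] //= /andP[at_ st].
rewrite pairwise_cat pairwise_map IH // andbT; apply/andP; split; last first.
  apply: sub_pairwise (IH k st) => b c bc.
  by rewrite /= [(_ <= _)%O]lexi_cons lexx bc.
apply/allrelP => _ c /mapP[b bt ->]; rewrite mem_ksubs.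
case: c => // e c /andP[_ /mem_subseq ct].
have ae : (a < e)%O by apply: (allP at_); apply/ct/mem_head.
by rewrite [(_ <= _)%O]lexi_cons ltW //= leNgt ae.
Qed.

(** * Commutation and reversal of products in a monoid *)

Section Products.

Variable G : monoidType.

Lemma commute_prod_seq (I : eqType) (r : seq I) (F : I -> G) x :
  {in r, forall i, commute x (F i)} -> commute x (\prod_(i <- r) F i).
Proof. by move=> xF; rewrite big_seq; apply: commute_prod. Qed.

Lemma commute_prods_seq (I J : eqType) (r : seq I) (s : seq J)
    (F : I -> G) (H : J -> G) :
    {in r & s, forall i j, commute (F i) (H j)} ->
  commute (\prod_(i <- r) F i) (\prod_(j <- s) H j).
Proof.
move=> FH; apply: commute_prod_seq => j js; apply: commute_sym.
by apply: commute_prod_seq => i ir; apply/commute_sym/FH.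
Qed.

(** Each [H i] moves right past the [F j] with [j] later in [r]; these [j] differ from [i]. *)
Lemma prod_interleave (I : eqType) (r : seq I) (F H : I -> G) :
    uniq r -> {in r &, forall i j, i != j -> commute (F i) (H j)} ->
  \prod_(i <- r) (F i * H i) = \prod_(i <- r) F i * \prod_(i <- r) H i.
Proof.
elim: r => [|i r IH] /=; first by rewrite !big_nil mulg1.
case/andP=> ir ur FH; rewrite !big_cons IH //; last first.
  by move=> j l jr lr; apply: FH; rewrite inE ?jr ?lr orbT.
rewrite -!mulgA; congr (_ * _); rewrite !mulgA; congr (_ * _).
apply: commute_prod_seq => j jr; apply/commute_sym/FH.
- by rewrite inE jr orbT.
- exact: mem_head.
- by apply: contraNneq ir => <-.
Qed.

(** Putting [a] on both lists raises the intersection by one. If only [a :: b] contains [a], the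
    intersection is that of [b] with [c], of the critical size [k] only when [b] lies in [c]. *)
Lemma commute_cone (T : eqType) (a : T) (t : seq T) k (x : seq T -> G) :
    a \notin t ->
    {in ksubs k.+1 (a :: t) &, forall b b' : seq T,
       (count (mem b') b).+1 <> k.+1 -> commute (x b) (x b')} ->
  {in ksubs k t &, forall b b' : seq T,
     (count (mem b') b).+1 <> k -> commute (x (a :: b)) (x (a :: b'))} /\
  {in ksubs k t & ksubs k.+1 t, forall b c : seq T,
     ~~ all (mem c) b -> commute (x (a :: b)) (x c)}.
Proof.
move=> at_ Cx; split=> [b b' bt bt' Cbb'|b c bt ct bc]; apply: Cx.
- by rewrite /= mem_cat map_f.
- by rewrite /= mem_cat map_f.
- by rewrite /= mem_head (count_ksubs_cons _ at_ bt) => -[/Cbb'].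
- by rewrite /= mem_cat map_f.
- by rewrite /= mem_cat ct orbT.
move: bc; rewrite all_count (size_ksubs bt) /= (negPf (ksubs_notin at_ ct)) add0n.
by move=> bc [/eqP]; apply/negP.
Qed.

(* Let a be the first point of s; write x = x1 x2 and y = y1 y2 according to
   whether a occurs. Then x1 is reversed by x2 y1, read as the product of the
   x d * y (a :: d), and x2 is then reversed by y2. Since x d * y (a :: d) turns
   into y' (a :: d) * x d, the induction needs y' to differ from y. *)
Lemma prod_ksubs_flip (T : eqType) (s : seq T) k (x y y' : seq T -> G) :
    uniq s ->
    {in ksubs k s &, forall b b' : seq T,
       (count (mem b') b).+1 <> k -> commute (x b) (x b')} ->
    {in ksubs k s & ksubs k.+1 s, forall b c : seq T,
       ~~ all (mem c) b -> commute (x b) (y c)} ->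
    {in ksubs k s & ksubs k.+1 s, forall b c : seq T,
       ~~ all (mem c) b -> commute (x b) (y' c)} ->
    {in ksubs k.+1 s, forall c : seq T,
       \prod_(b <- ksubs k c) x b * y c =
       y' c * \prod_(b <- rev (ksubs k c)) x b} ->
  \prod_(b <- ksubs k s) x b * \prod_(c <- ksubs k.+1 s) y c =
  \prod_(c <- ksubs k.+1 s) y' c * \prod_(b <- rev (ksubs k s)) x b.
Proof.
elim: s k x y y' => [|a t IH] [|k] x y y' us Cx Cy Cy' E;
  rewrite ?[ksubs 0 _]/= ?[ksubs _ [::]]/= ?big_seq1 ?big_nil ?mul1g ?mulg1 //.
  (* For [k = 0] the only [x] factor is [x [::]], which passes the [y c] one at a time. *)
  have {}E : {in ksubs 1 (a :: t), forall c, x [::] * y c = y' c * x [::]}.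
    by move=> c /E; case: c => [|? ?]; rewrite /= !big_seq1.
  elim: (ksubs 1 _) E => [|c r IHr] E; first by rewrite !big_nil mulg1 mul1g.
  rewrite !big_cons mulgA E ?mem_head // -!mulgA IHr // => d dr.
  by apply: E; rewrite inE dr orbT.
have [at_ ut] : a \notin t /\ uniq t by apply/andP.
have in1 j (b : seq T) : b \in ksubs j t -> a :: b \in ksubs j.+1 (a :: t).
  by move=> bt; rewrite /= mem_cat map_f.
have in2 j (b : seq T) : b \in ksubs j.+1 t -> b \in ksubs j.+1 (a :: t).
  by move=> bt; rewrite /= mem_cat bt orbT.
have allN j (b d : seq T) : b \in ksubs j t -> ~~ all (mem d) b ->
    ~~ all (mem (a :: d)) b.
  by move=> bt; rewrite !all_count (count_ksubs_cons _ at_ bt).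
(* Equal length turns containment into equality, so distinct [d], [d'] meet the non-containment
   condition of [Cy] and [Cy']. *)
have eq_of_all (d d' : seq T) : d \in ksubs k.+1 t -> d' \in ksubs k.+1 t ->
    all (mem d') d -> d = d'.
  rewrite !mem_ksubs => /andP[/eqP sd dt] /andP[/eqP sd' dt'] /allP dd'.
  have sdd : size d' <= size d by rewrite sd sd'.
  have [_ dE] := uniq_min_size (subseq_uniq dt ut) dd' sdd.
  have /(subseq_uniqP ut) -> := dt; have /(subseq_uniqP ut) -> := dt'.
  by apply: eq_filter => e; apply: dE.
have [Cxx1 Cxx] := commute_cone at_ Cx.
rewrite [ksubs k.+1 (a :: t)]/= [ksubs k.+2 (a :: t)]/= rev_cat -map_rev !big_cat !big_map /=.
set X1 := \prod_(b <- ksubs k t) x (a :: b).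
set X1r := \prod_(b <- rev (ksubs k t)) x (a :: b).
set X2 := \prod_(b <- ksubs k.+1 t) x b.
set X2r := \prod_(b <- rev (ksubs k.+1 t)) x b.
set Y1 := \prod_(d <- ksubs k.+1 t) y (a :: d).
set Y2 := \prod_(c <- ksubs k.+2 t) y c.
set Y1' := \prod_(d <- ksubs k.+1 t) y' (a :: d).
set Y2' := \prod_(c <- ksubs k.+2 t) y' c.
have E2 : X2 * Y2 = Y2' * X2r.
  apply: IH => //.
  - by move=> b b' bt bt'; apply: Cx; apply: in2.
  - by move=> b c bt ct; apply: Cy; apply: in2.
  - by move=> b c bt ct; apply: Cy'; apply: in2.
  - by move=> c ct; apply/E/in2.
have XY : X2 * Y1 = \prod_(d <- ksubs k.+1 t) (x d * y (a :: d)).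
  rewrite prod_interleave ?ksubs_uniq // => d d' dt d't ne.
  apply: Cy; [exact: in2 | exact: in1 |].
  by apply/(allN _ _ _ dt)/(contra_neqN _ ne)/eq_of_all.
have YX : Y1' * X2 = \prod_(d <- ksubs k.+1 t) (y' (a :: d) * x d).
  rewrite prod_interleave ?ksubs_uniq // => d d' dt d't ne.
  apply/commute_sym/Cy'; [exact: in2 | exact: in1 |].
  apply/(allN _ _ _ d't)/(contra_neqN _ ne) => ?; exact/esym/eq_of_all.
have E1 : X1 * (X2 * Y1) = Y1' * X2 * X1r.
  rewrite XY YX; apply: (IH k (fun b => x (a :: b))) => //.
  - move=> b c bt ct bc; apply: commuteM; first exact: Cxx.
    apply: Cy; try exact: in1.
    by rewrite /= mem_head /= (allN _ _ _ bt).
  - move=> b c bt ct bc; apply: commuteM; last exact: Cxx.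
    apply: Cy'; try exact: in1.
    by rewrite /= mem_head /= (allN _ _ _ bt).
  (* In the packet of [a :: c] the list [c] comes last, so [x c] stands next to [y (a :: c)]; after
     reversal it comes first, next to [y' (a :: c)]. *)
  - move=> c ct; move: (E _ (in1 _ _ ct)).
    rewrite (ksubs_cons_size a (size_ksubs ct)) rev_rcons -map_rev.
    by rewrite big_rcons /= big_cons !big_map !mulgA.
(* A list through [a] is never contained in a list of [t], so the reversed first block passes [Y2]
   freely. *)
have C12 : commute X1r Y2.
  apply: commute_prods_seq => b c; rewrite mem_rev => bt ct.
  apply: Cy; [exact: in1 | exact: in2 |].
  by rewrite /= (negPf (ksubs_notin at_ ct)).
rewrite -[LHS]mulgA [X2 * (Y1 * Y2)]mulgA [LHS]mulgA E1 -[LHS]mulgA C12.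
by rewrite -mulgA [X2 * (Y2 * _)]mulgA E2 !mulgA.
Qed.

Lemma prod_ksubs_rev (T : eqType) (s : seq T) n (r : seq T -> G) :
    uniq s -> 0 < n ->
    {in ksubs n s &, forall a b : seq T,
       (count (mem b) a).+1 <> n -> commute (r a) (r b)} ->
    {in ksubs n.+1 s, forall a : seq T,
       \prod_(b <- ksubs n a) r b = \prod_(b <- rev (ksubs n a)) r b} ->
  \prod_(b <- ksubs n s) r b = \prod_(b <- rev (ksubs n s)) r b.
Proof.
case: n => // k us _; elim: s us => [|a t IH] us Cr E; first by rewrite !big_nil.
have [at_ ut] : a \notin t /\ uniq t by apply/andP.
have in2 j (b : seq T) : b \in ksubs j.+1 t -> b \in ksubs j.+1 (a :: t).
  by move=> bt; rewrite /= mem_cat bt orbT.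
have {}IH : \prod_(b <- ksubs k.+1 t) r b = \prod_(b <- rev (ksubs k.+1 t)) r b.
  apply: IH => //; first by move=> b b' bt bt'; apply: Cr; apply: in2.
  by move=> c ct; apply/E/in2.
have [Crr1 Crr] := commute_cone at_ Cr.
rewrite /= rev_cat -map_rev !big_cat !big_map /= -IH.
apply: (prod_ksubs_flip (x := fun b => r (a :: b))) => // c ct.
(* Since [c] is last in the packet of [a :: c], its relation is the exchange hypothesis with [y] and
   [y'] both equal to [r]. *)
have := E (a :: c); rewrite (ksubs_cons_size a (size_ksubs ct)) rev_rcons -map_rev.
by rewrite big_rcons /= big_cons !big_map; apply; rewrite mem_cat map_f.
Qed.

End Products.

(** * Increasing tuples as subsequences of the index range *)

Section IncreasingSequences.

Variables n N : nat.
Implicit Types a b : incr_seq n N.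

Lemma incr_seq_uniq a : uniq a.
Proof. exact: lt_sorted_uniq (valP a). Qed.

Lemma enum_ord_ltsorted : sorted <%O (enum 'I_N).
Proof.
suff: sorted ltn [seq val i | i <- enum 'I_N] by rewrite sorted_map.
by rewrite val_enum_ord iota_ltn_sorted.
Qed.

Lemma mem_ksubs_enum (s : seq 'I_N) :
  reflect (exists a, s = ival a) (s \in ksubs n (enum 'I_N)).
Proof.
rewrite mem_ksubs; apply: (iffP andP) => [[sz sub]|[a ->]].
  have srt : sorted <%O s by apply: subseq_sorted sub enum_ord_ltsorted; apply: lt_trans.
  by exists (@IncrSeq n N (Tuple sz) srt).
split; first by rewrite size_tuple.
(* An increasing list is determined by its members, hence is a filter of the full range. *)
have -> : tval (ival a) = [seq i <- enum 'I_N | i \in ival a].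
  apply: lt_sorted_eq; first exact: valP a.
    exact/lt_sorted_filter/enum_ord_ltsorted.
  by move=> i; rewrite mem_filter mem_enum andbT.
exact: filter_subseq.
Qed.

(** Both sides are lexicographically sorted, without repetition and with the same members; such a
    list is unique. *)
Lemma lex_seqsE : [seq tval (ival a) | a <- lex_seqs n N] = ksubs n (enum 'I_N).
Proof.
apply: (@le_sorted_eq _ (seqlexi 'I_N)).
- rewrite sorted_map; apply: sort_sorted => a b; exact: le_total.
- rewrite sorted_pairwise; last exact: le_trans.
  exact: ksubs_le (enum_ord_ltsorted).
apply: uniq_perm.
- rewrite map_inj_uniq ?sort_uniq ?enum_uniq //.
  by move=> a b /val_inj/val_inj.
- exact/ksubs_uniq/enum_uniq.
move=> s; apply/mapP/mem_ksubs_enum => [[a _ ->]|[a ->]]; exists a => //.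
by rewrite mem_sort mem_enum.
Qed.

Lemma card_setI_count a b :
  #|[set i in ival a] :&: [set i in ival b]| = count (mem (ival b)) (ival a).
Proof.
rewrite -size_filter -(card_uniqP (filter_uniq _ (incr_seq_uniq a))).
by apply: eq_card => i; rewrite !inE mem_filter andbC.
Qed.

End IncreasingSequences.

(** * Packets of deletions and transfer to the group *)

Lemma ival_del n N (a : incr_seq n.+1 N) (j : 'I_n.+1) :
  tval (ival (del a j)) = take j a ++ drop j.+1 a.
Proof.
have x0 : 'I_N := tnth a j.
have sza : size a = n.+1 by rewrite size_tuple.
have szt : size (take j a) = j by rewrite size_takel // sza ltnW.
apply: (@eq_from_nth _ x0) => [|i].
  rewrite size_cat szt size_drop sza subSS size_tuple.
  by rewrite subnKC // -ltnS.
rewrite size_tuple => lti; rewrite -[i]/(val (Ordinal lti)) nth_mktuple.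
rewrite (tnth_nth x0) /= nth_cat szt nth_drop /bump.
case: leqP => ji; last by rewrite add0n nth_take.
by rewrite add1n addSn subnKC.
Qed.

(** The reversal arises because [ksubs] drops the last entry first, while the simplex relation runs
    through [j] upwards. *)
Lemma ksubs_del n N (a : incr_seq n.+1 N) :
  ksubs n (tval (ival a)) =
  [seq tval (ival b) | b <- rev [seq del a j | j <- enum 'I_n.+1]].
Proof.
rewrite ksubs_drop1 ?size_tuple // map_rev -map_comp -val_enum_ord -map_comp.
by congr (rev _); apply: eq_map => j; rewrite /= ival_del.
Qed.

(* Junk value 1 unless s is increasing of size n. *)
Definition Rseq n N (s : seq 'I_N) : B n N :=
  oapp (@R n N) 1 [pick a : incr_seq n N | tval (ival a) == s].

Lemma Rseq_ival n N (a : incr_seq n N) : Rseq n (ival a) = R a.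
Proof.
rewrite /Rseq; case: pickP => [b /eqP/val_inj/val_inj -> //|/(_ a)].
by rewrite eqxx.
Qed.

Lemma prod_Rseq n N (l : seq (incr_seq n N)) :
  \prod_(b <- [seq tval (ival a) | a <- l]) Rseq n b = \prod_(a <- l) R a.
Proof. by rewrite big_map; apply: eq_bigr => a _; rewrite Rseq_ival. Qed.

Theorem theorem2 (n N : nat) (n_gt0 : 0 < n) (le_nN : n <= N) : W n N = Wbar n N.
Proof.
rewrite WbarE /W -!prod_Rseq map_rev lex_seqsE.
apply: prod_ksubs_rev => //; first exact: enum_uniq.
  move=> _ _ /mem_ksubs_enum[a ->] /mem_ksubs_enum[b ->] ne.
  rewrite /commute !Rseq_ival; apply: B_comm; rewrite card_setI_count.
  (* Positivity of [n] makes [n.-1] a true predecessor, which matches the two forms of the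
     condition. *)
  by move=> e; apply: ne; rewrite e prednK.
move=> _ /mem_ksubs_enum[a ->].
rewrite ksubs_del -(map_rev (fun b => tval (ival b))) !prod_Rseq revK.
exact/esym/presented_rel/Brel_simplex.
Qed.
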